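(* For every $\epsilon > 0$ there is a constant $c_\epsilon > 0$ such that there exist infinitely many finite groups $G$, each having a nontrivial irreducible unitary representation $\rho$ with the following property: for every positive integer $k \le c_\epsilon \log\log|G|$ and all $g_1, \dots, g_k \in G$, \[ \left\| \frac{\rho(g_1) + \cdots + \rho(g_k)}{k} \right\|_{\mathrm{op}} \ge 1 - \epsilon . \] In particular, $\rho$ $\epsilon$-resists every subset $S \subset G$ with $|S| \le c_\epsilon \log\log |G|$.
   Context: For a finite group $G$, a unitary representation $\rho$ of $G$ and a nonempty subset $S\subset G$, one says $S$ is $\epsilon$-expanding with respect to $\rho$ if $\bigl\|\frac{1}{|S|}\sum_{g\in S}\rho(g)\bigr\|_{\mathrm{op}} \le 1-\epsilon$, where $\|\cdot\|_{\mathrm{op}}$ is the operator norm; otherwise one says $\rho$ $\epsilon$-resists $S$. A nontrivial representation is one that is not the trivial one-dimensional representation. *)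

(* Defs.v *)
From HB Require Import structures.
From mathcomp Require Import all_boot all_order all_algebra all_fingroup.
From mathcomp Require Import mxrepresentation complex.
From mathcomp Require Import boolp classical_sets reals exp.

Set Implicit Arguments.
Unset Strict Implicit.
Unset Printing Implicit Defensive.

Import Order.TTheory GRing.Theory Num.Theory.
Local Open Scope ring_scope.

(* Matrix representations act on row vectors on the right, [v |-> v *m rG g],
   and [mx_irreducible] refers to this action; operator norms are therefore
   taken for right multiplication too. *)

(* [dotmx v v] is real and nonnegative, so nothing is lost by [complex.Re]. *)
Definition l2norm (R : realType) (n : nat) (v : 'rV[R[i]]_n) : R :=
  Num.sqrt (complex.Re (dotmx v v)).

(* The set is nonempty, and bounded since the dimension is finite, so the total
   function [sup] returns its actual supremum. *)
Definition opnorm (R : realType) (n : nat) (A : 'M[R[i]]_n) : R :=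
  sup [set l2norm (v *m A) | v in [set v : 'rV[R[i]]_n | l2norm v <= 1]]%classic.

Section Representations.
Variables (R : realType) (gT : finGroupType) (G : {group gT}) (n : nat).
Variable rG : mx_representation R[i] G n.

Definition unitary_repr : Prop := forall g, g \in G -> rG g \is unitarymx.

Definition trivial_repr : Prop := n = 1%N /\ forall g, g \in G -> rG g = 1%:M.

Definition expanding (eps : R) (S : {set gT}) : Prop :=
  opnorm (#|S|%:R^-1 *: \sum_(g in S) rG g) <= 1 - eps.

Definition resists (eps : R) (S : {set gT}) : Prop := ~ expanding eps S.

End Representations.

(* Main.v *)
From HB Require Import structures.
From mathcomp Require Import classical_sets.
Require Import Defs.
From mathcomp Require Import all_boot all_order all_algebra all_fingroup.
From mathcomp Require Import mxrepresentation complex.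
From mathcomp Require Import reals exp.
From mathcomp Require Import ring lra zify.

(* Take [G] to be the affine group of [F_p], acting on the functions on [F_p]
   of mean zero. This group is metabelian, and free metabelian groups are
   amenable: for [k] generators and a fixed precision there is a Folner set of
   size [exp (C^k)]. Acting on a point of [F_p] by this set produces a
   multiplicity function [m] on [F_p] of total mass [N <= exp (C^k)] that is
   almost invariant under [g_1, ..., g_k]. The vector [sqrt m] is then almost
   invariant too, and its projection to the constants is negligible as soon as
   [N] is much smaller than [p], that is, when [k] is at most a small multiple
   of [log log p]. *)

Set Implicit Arguments.
Unset Strict Implicit.
Unset Printing Implicit Defensive.

Import Order.TTheory GRing.Theory Num.Theory.

Local Open Scope ring_scope.

(** * Cauchy-Schwarz and lower bounds for the operator norm *)

Lemma complex_sqr_le (R : realType) (z : R[i]) (a b : R) :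
    `|z| ^+ 2 <= a%:C%C * b%:C%C ->
  complex.Re z ^+ 2 + complex.Im z ^+ 2 <= a * b.
Proof. by rewrite -add_Re2_Im2 -rmorphM lecR. Qed.

Lemma Re_le_sqrt (R : realType) (z : R[i]) (a b : R) : 0 <= a ->
    complex.Re z ^+ 2 + complex.Im z ^+ 2 <= a * b ->
  complex.Re z <= Num.sqrt a * Num.sqrt b.
Proof.
move=> a_ge0 le_ab; apply: le_trans (ler_norm _) _.
rewrite -sqrtr_sqr -sqrtrM // ler_wsqrtr //.
by apply: le_trans le_ab; rewrite lerDl sqr_ge0.
Qed.

Section OperatorNorm.
Variables (R : realType) (n : nat).
Implicit Types (u v : 'rV[R[i]]_n) (A : 'M[R[i]]_n).
Local Notation sqnorm v := (complex.Re (dotmx v v)).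

Lemma dotmx_ge0 v : 0 <= dotmx v v. Proof. exact: (dnorm_ge0 (@dotmx _ n)). Qed.

Lemma dotmx_Re v : (sqnorm v)%:C%C = dotmx v v.
Proof. by rewrite RRe_real // ger0_real // dotmx_ge0. Qed.

Lemma sqnorm_ge0 v : 0 <= sqnorm v.
Proof. by rewrite -ler0c dotmx_Re dotmx_ge0. Qed.

Lemma l2norm_sqr v : l2norm v ^+ 2 = sqnorm v.
Proof. exact/sqr_sqrtr/sqnorm_ge0. Qed.

Lemma l2norm_ge0 v : 0 <= l2norm v. Proof. exact: sqrtr_ge0. Qed.

Lemma sqnorm_dotmx_le u v :
  complex.Re (dotmx u v) ^+ 2 + complex.Im (dotmx u v) ^+ 2 <= sqnorm u * sqnorm v.
Proof.
have CS : `|dotmx u v| ^+ 2 <= dotmx u u * dotmx v v.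
  by have [] := CauchySchwarz (@dotmx _ n) u v.
apply: complex_sqr_le; apply: le_trans CS _.
by rewrite [X in _ <= X * _]dotmx_Re [X in _ <= _ * X]dotmx_Re.
Qed.

Lemma Re_dotmx_le u v : complex.Re (dotmx u v) <= l2norm u * l2norm v.
Proof. exact: Re_le_sqrt (sqnorm_ge0 u) (sqnorm_dotmx_le u v). Qed.

Lemma sqnormE v :
  sqnorm v = \sum_j (complex.Re (v 0 j) ^+ 2 + complex.Im (v 0 j) ^+ 2).
Proof.
apply: complexI; rewrite dotmx_Re rmorph_sum /= dotmxE mxE.
by apply: eq_bigr => j _; rewrite add_Re2_Im2 normCK !mxE.
Qed.

(** Cauchy-Schwarz on each column gives the Hilbert-Schmidt bound. It serves to show that the
    supremum defining [opnorm] is taken over a bounded set. *)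
Lemma sqnorm_mulmx_le v A :
  sqnorm (v *m A) <= sqnorm v * \sum_j sqnorm ((col j A)^t* )%sesqui.
Proof.
rewrite [leLHS]sqnormE mulr_sumr; apply: ler_sum => j _.
have -> : (v *m A) 0 j = dotmx v ((col j A)^t* )%sesqui.
  by rewrite dotmxE !mxE; apply: eq_bigr => l _; rewrite !mxE conjCK.
exact: sqnorm_dotmx_le.
Qed.

Lemma l2norm_mulmx_le_opnorm v A : l2norm v <= 1 -> l2norm (v *m A) <= opnorm A.
Proof.
move=> v1; apply: ub_le_sup; last by exists v.
exists (Num.sqrt (\sum_j sqnorm ((col j A)^t* )%sesqui)) => _ [u /= u1 <-].
apply: ler_wsqrtr; apply: le_trans (sqnorm_mulmx_le u A) _.
apply: ler_piMl; first by apply: sumr_ge0 => j _; apply: sqnorm_ge0.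
by rewrite -l2norm_sqr expr_le1 ?l2norm_ge0.
Qed.

(** Rayleigh quotient: after normalizing [u] to a unit vector [v], Cauchy-Schwarz bounds the real
    part of the inner product of [v *m A] and [v] by the norm of [v *m A]. *)
Lemma opnorm_ge u A r : u != 0 ->
  r * sqnorm u <= complex.Re (dotmx (u *m A) u) -> r <= opnorm A.
Proof.
move=> u_neq0 ru.
have N2_gt0 : 0 < sqnorm u.
  rewrite -ltcR dotmx_Re; exact: dotmx_is_dotmx.
pose N := l2norm u; have N_gt0 : 0 < N by rewrite sqrtr_gt0.
have N2 : N ^+ 2 = sqnorm u by apply: l2norm_sqr.
pose v : 'rV[R[i]]_n := (N^-1)%:C%C *: u.
have v_dot w : complex.Re (dotmx ((N^-1)%:C%C *: w) v) =
               complex.Re (dotmx w u) / N ^+ 2.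
  have -> : dotmx ((N^-1)%:C%C *: w) v = (N^-1)%:C%C * ((N^-1)%:C%C * dotmx w u).
    rewrite linearZl_LR linearZr_LR /=; congr (_ * (_ * _)); exact: conjc_real.
  rewrite mulrA -rmorphM.
  by case: (dotmx w u) => a b /=; rewrite mul0r subr0 -invfM mulrC.
have v1 : l2norm v = 1.
  by rewrite /l2norm v_dot N2 divff ?sqrtr1 // gt_eqF.
apply: le_trans (l2norm_mulmx_le_opnorm A (_ : l2norm v <= 1)); last by rewrite v1.
rewrite -[leRHS]mulr1 -[X in _ * X]v1; apply: le_trans (Re_dotmx_le _ _).
rewrite -scalemxAl [leRHS]v_dot N2 (ler_pdivlMr _ _ N2_gt0).
exact: ru.
Qed.

End OperatorNorm.

(** * Cyclic increments, and the Folner set built from them *)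

Section CyclicIncrement.
Variables (I : finType) (l : nat).
Implicit Type f : {ffun I -> 'I_l.+1}.

(** Wrapping around at [l] makes the increment a bijection of the box; it differs from adding 1 only
    on the face where the coordinate [i] equals [l]. *)
Definition incr (i : I) f : {ffun I -> 'I_l.+1} :=
  [ffun x => if x == i then ordS (f x) else f x].

Lemma incr_inj i : injective (incr i).
Proof.
move=> f g /ffunP fg; apply/ffunP=> x; have := fg x; rewrite !ffunE.
by case: eqP => // _; apply: (can_inj (@ordSK l.+1)).
Qed.

Lemma incr_val i f x : (f i < l)%N -> incr i f x = (f x + (x == i))%N :> nat.
Proof.
move=> fil; rewrite ffunE; case: eqP => [->|_] /=; last by rewrite addn0.
by rewrite modn_small // addn1.
Qed.

End CyclicIncrement.

(** The map [f] sends each fiber of [h] injectively into the next one. Going once around the cycle,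
    all [l.+1] fibers have the same size. *)
Lemma card_fiber_max (T : finType) (l : nat) (f : T -> T) (h : T -> 'I_l.+1) :
    injective f -> (forall x, h (f x) = ordS (h x)) ->
  (l.+1 * #|[set x | h x == ord_max]| <= #|T|)%N.
Proof.
move=> f_inj hf; pose fib a := [set x | h x == a].
have fibS a : (#|fib a| <= #|fib (ordS a)|)%N.
  rewrite -(card_imset _ f_inj); apply/subset_leq_card/subsetP=> _ /imsetP[x + ->].
  by rewrite !inE hf => /eqP->.
have fib_max a : (#|fib ord_max| <= #|fib a|)%N.
  case: a => a; elim: a => [|a IHa] al.
    have -> : Ordinal al = ordS ord_max by apply: val_inj; rewrite /= modnn.
    exact: fibS.
  have -> : Ordinal al = ordS (Ordinal (ltnW al)).
    by apply: val_inj; rewrite /= modn_small.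
  exact: leq_trans (IHa _) (fibS _).
have -> : #|T| = (\sum_(a < l.+1) #|fib a|)%N.
  rewrite -sum1_card (partition_big h predT) //=.
  by apply: eq_bigr => a _; rewrite -sum1_card; apply: eq_bigl => x; rewrite inE.
rewrite -[X in (X * _)%N]card_ord -sum_nat_const.
by apply: leq_sum => a _; apply: fib_max.
Qed.

(* In the free metabelian group on [k] letters, the elements whose abelianization
   lies in a box of [Z^k] and whose flow uses each edge of that box boundedly
   often form a Folner set. Its image in the affine group, with [j] sent to
   [y |-> y * s j + v j], acts on the point [0]; [point] is the resulting family
   of points of [F], indexed with multiplicities by [config]. *)
Section FolnerSet.
Variables (F : finFieldType) (k l : nat) (s v : 'I_k -> F).
Hypothesis s_neq0 : forall j, s j != 0.

Definition box := {ffun 'I_k -> 'I_l.+1}.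

Definition config := (box * {ffun box * 'I_k -> 'I_l.+1})%type.

Lemma card_config : #|{: config}| = (l.+1 ^ (k + l.+1 ^ k * k))%N.
Proof. by rewrite card_prod !card_ffun card_prod card_ffun !card_ord expnD. Qed.

Definition scale (n : box) : F := \prod_i s i ^+ n i.

Definition point (om : config) : F :=
  - (\sum_q (om.2 q)%:R * scale q.1 * v q.2) / scale om.1.

Definition step (j : 'I_k) (om : config) : config :=
  (incr j om.1, incr (om.1, j) om.2).

(** On these configurations neither increment in [step j] wraps around, so the cyclic step is a
    genuine one. *)
Definition interior (j : 'I_k) : {set config} :=
  [set om : config | (om.1 j < l)%N && (om.2 (om.1, j) < l)%N].

Lemma step_inj j : injective (step j).
Proof.
by move=> [n c] [n' c'] [/incr_inj <-] /incr_inj <-.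
Qed.

Lemma scale_neq0 n : scale n != 0.
Proof. by apply/prodf_neq0 => i _; rewrite expf_neq0. Qed.

Lemma scale_incr j (n : box) : (n j < l)%N -> scale (incr j n) = s j * scale n.
Proof.
move=> nj; rewrite /scale (bigD1 j) //= [in RHS](bigD1 j) //= mulrA.
congr (_ * _); first by rewrite incr_val // eqxx addn1 exprS.
by apply: eq_bigr => i /negPf ij; rewrite incr_val // ij addn0.
Qed.

(** Attach to [om = (n, c)] the affine map with slope [scale n] and translation part the sum in
    [point]; then [point om] is its zero. A step along [j] precomposes this map with
    [y |-> y * s j + v j], which therefore sends the new zero to the old one. *)
Lemma point_step j (om : config) :
  om \in interior j -> point om = point (step j om) * s j + v j.
Proof.
case: om => n c; rewrite inE /= => /andP[nj cj].
rewrite /point /= scale_incr //.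
have -> : \sum_q (incr (n, j) c q)%:R * scale q.1 * v q.2 =
    \sum_q (c q)%:R * scale q.1 * v q.2 + scale n * v j.
  rewrite (bigD1 (n, j)) //= [in RHS](bigD1 (n, j)) //= incr_val // eqxx addn1.
  rewrite -natr1 !mulrDl mul1r -!addrA; congr (_ + _); rewrite addrC.
  congr (_ + _); apply: eq_bigr => q /negPf qj.
  by rewrite incr_val // qj addn0.
by field; rewrite s_neq0 scale_neq0.
Qed.

(** A configuration outside the interior has one of two cyclic coordinates equal to [l], and each
    case has proportion at most [1 / l.+1] by [card_fiber_max]. *)
Lemma card_interior j :
  (l.+1 * #|{: config}| <= l.+1 * #|interior j| + 2 * #|{: config}|)%N.
Proof.
pose B1 := [set om : config | om.1 j == ord_max].
pose B2 := [set om : config | om.2 (om.1, j) == ord_max].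
have cB1 : (l.+1 * #|B1| <= #|{: config}|)%N.
  apply: (@card_fiber_max _ _ (fun om : config => (incr j om.1, om.2))
            (fun om : config => om.1 j)) => [[n c] [n' c'] [/incr_inj -> ->] //|].
  by move=> om; rewrite ffunE eqxx.
have cB2 : (l.+1 * #|B2| <= #|{: config}|)%N.
  (* Only the flow is incremented, so the edge [(om.1, j)] being read stays the same. *)
  apply: (@card_fiber_max _ _
            (fun om : config => (om.1, incr (om.1, j) om.2))
            (fun om : config => om.2 (om.1, j))).
    by move=> [n c] [n' c'] [<-] /incr_inj ->.
  by move=> om; rewrite ffunE eqxx.
have cover : (#|{: config}| <= #|interior j| + (#|B1| + #|B2|))%N.
  apply: leq_trans (leq_add (leqnn _) (leq_card_setU B1 B2)).
  apply: leq_trans (leq_card_setU _ _); apply/subset_leq_card/subsetP => om _.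
  rewrite !inE -!val_eqE /=.
  have := leq_ord (om.1 j); have := leq_ord (om.2 (om.1, j)).
  by case: (ltngtP (om.1 j) l); case: (ltngtP (om.2 (om.1, j)) l).
apply: leq_trans (leq_mul (leqnn l.+1) cover) _.
by rewrite !mulnDr leq_add2l mul2n -addnn leq_add.
Qed.

Definition mult (y : F) : nat := #|[set om | point om == y]|.

Lemma sum_mult : (\sum_y mult y = #|{: config}|)%N.
Proof.
rewrite -sum1_card (partition_big point predT) //=; apply: eq_bigr => y _.
by rewrite /mult -sum1_card; apply: eq_bigl => om; rewrite inE.
Qed.

(** Sort the interior by [y = point (step j om)]. Each class embeds into the fiber of [point] over
    [y] through [step j], and lies in the fiber over [y * s j + v j] by [point_step]. *)
Lemma mult_invariant j :
  (#|interior j| <= \sum_y minn (mult y) (mult (y * s j + v j)%R))%N.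
Proof.
rewrite -sum1_card (partition_big (point \o step j) predT) //=.
apply: leq_sum => y _; rewrite sum1_card leq_min; apply/andP; split.
  rewrite -(card_imset _ (@step_inj j)).
  apply/subset_leq_card/subsetP => _ /imsetP[om + ->].
  by rewrite !inE => /andP[_].
apply/subset_leq_card/subsetP => om /andP[om_in /eqP yE].
by rewrite inE (point_step om_in) -yE.
Qed.

End FolnerSet.

(** * The affine group of a finite field *)

Section AffineGroup.
Variable F : finFieldType.

(* The pair [(v, s)] is the affine map [y |-> y * s + v], composed from left to
   right. *)
Definition aff := (F * {unit F})%type.

HB.instance Definition _ := Finite.on aff.

Implicit Types g h : aff.

Definition aff_one : aff := (0, 1%g).
Definition aff_mul g h : aff := (g.1 * val h.2 + h.1, (g.2 * h.2)%g).
Definition aff_inv g : aff := (- g.1 * (val g.2)^-1, (g.2^-1)%g).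

Lemma aff_mulA : associative aff_mul.
Proof.
move=> g h l; rewrite /aff_mul /= mulgA; congr (_, _).
by rewrite mulrDl -mulrA -addrA.
Qed.

Lemma aff_mul1 : left_id aff_one aff_mul.
Proof. by case=> v s; rewrite /aff_mul /= mul0r add0r mul1g. Qed.

Lemma aff_mulV : left_inverse aff_one aff_inv aff_mul.
Proof.
case=> v s; rewrite /aff_mul /aff_inv /aff_one /= mulVg; congr (_, _).
by rewrite divrK ?addNr // (valP s).
Qed.

HB.instance Definition _ := Finite_isGroup.Build aff aff_mulA aff_mul1 aff_mulV.

Lemma unit_neq0 (s : {unit F}) : val s != 0.
Proof. by rewrite -unitfE (valP s). Qed.

Lemma card_aff : #|{: aff}| = (#|F| * #|F|.-1)%N.
Proof. by rewrite card_prod -[in RHS]card_finField_unit cardsT. Qed.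

End AffineGroup.

(** * Its mean-zero representation: unitarity, Parseval and irreducibility *)

Section AffineRepresentation.
Variables (R : realType) (F : finFieldType) (psi : F -> R[i]).
Hypothesis psiD : {morph psi : a b / a + b >-> a * b}.
Hypothesis psi0 : psi 0 = 1.
Hypothesis psiN : forall a, psi (- a) = (psi a)^*%C.
Hypothesis psi_nontrivial : exists a, psi a != 1.

Let n := #|{: {unit F}}|.
Let e (i : 'I_n) : {unit F} := enum_val i.
Let e_inj : injective e := @enum_val_inj _ _.
Let q : R := #|F|%:R.

Lemma sum_char a : \sum_x psi (x * a) = #|F|%:R *+ (a == 0).
Proof.
have [->|a0] := eqVneq.
  by rewrite (eq_bigr (fun=> 1)) ?sumr_const // => x _; rewrite mulr0 psi0.
have [b psib] := psi_nontrivial; apply/eqP.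
have : (psi b - 1) * \sum_x psi (x * a) == 0.
  rewrite mulrBl mul1r subr_eq0 mulr_sumr [eqbRHS](reindex_inj (addIr (b / a))).
  by apply/eqP/eq_bigr => x _; rewrite mulrDl divfK // psiD mulrC.
by rewrite mulf_eq0 subr_eq0 (negPf psib).
Qed.

Lemma sum_char_unit a : \sum_i psi (val (e i) * a) = #|F|%:R *+ (a == 0) - 1.
Proof.
rewrite -sum_char [X in X - 1](bigD1 0) //= mul0r psi0 [1 + _]addrC addrK.
rewrite -(big_enum_val (fun u : {unit F} => psi (val u * a))) /=.
rewrite [RHS](reindex_omap (op := +%R) val (insub : F -> option {unit F})) /=.
  by apply: eq_bigl => u; rewrite inE /= unit_neq0 valK eqxx.
by move=> x x0; rewrite insubT ?unitfE.
Qed.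

(* Fourier transform of the permutation action on functions on [F] of mean zero,
   in the basis of the nontrivial characters [y |-> psi (x * y)]. *)
Definition aff_mx (g : aff F) : 'M[R[i]]_n :=
  \matrix_(z, x) (psi (val (e x) * g.1) *+ (e z == g.2 * e x)%g).

Lemma aff_mxM g h : aff_mx (g * h)%g = aff_mx g *m aff_mx h.
Proof.
apply/matrixP => z y; rewrite !mxE.
rewrite (bigD1 (enum_rank (h.2 * e y)%g)) //= big1 ?addr0 => [|x].
  rewrite !mxE /e !enum_rankK eqxx mulr1n mulrnAl -psiD -mulgA.
  by congr (psi _ *+ _); rewrite /=; ring.
rewrite !mxE; have [<-|_ _] := eqVneq (e x); last by rewrite mulr0.
by rewrite /e enum_valK eqxx.
Qed.

Lemma aff_mx1 : aff_mx 1%g = 1%:M.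
Proof.
apply/matrixP => z x; rewrite !mxE /= mul1g mulr0 psi0.
by rewrite (inj_eq e_inj).
Qed.

Lemma aff_mx_repr : mx_repr [set: aff F] aff_mx.
Proof. by split=> [|g h _ _]; [exact: aff_mx1 | exact: aff_mxM]. Qed.

Definition aff_repr : mx_representation R[i] [set: aff F] n :=
  MxRepresentation aff_mx_repr.

Lemma aff_reprE g : aff_repr g = aff_mx g. Proof. by []. Qed.

Lemma aff_mxV g : ((aff_mx g)^t* )%sesqui = aff_mx g^-1%g.
Proof.
apply/matrixP => z x; rewrite !mxE raddfMn /= -[Num.conj _]psiN.
have -> : (e x == g.2 * e z)%g = (e z == g.2^-1 * e x)%g.
  by rewrite -[RHS](inj_eq (mulgI g.2)) mulKVg eq_sym.
case: eqP => [->|//]; congr (psi _ *+ _) => /=.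
by ring.
Qed.

Lemma aff_repr_unitary : unitary_repr aff_repr.
Proof.
move=> g _; apply/unitarymxP.
by rewrite aff_reprE aff_mxV -aff_mxM mulgV aff_mx1.
Qed.

(** Since the frequency 0 is left out, this is the Fourier transform of the projection of [w] to
    mean zero. *)
Definition fourier (w : F -> R) : 'rV[R[i]]_n :=
  \row_x \sum_y (w y)%:C%C * psi (val (e x) * y).

Lemma fourier_aff_repr w g : fourier w *m aff_repr g =
  \row_x \sum_y (w y)%:C%C * psi (val (e x) * (y * val g.2 + g.1)).
Proof.
apply/rowP => x; rewrite !mxE (bigD1 (enum_rank (g.2 * e x)%g)) //=.
rewrite big1 ?addr0 => [|z].
  rewrite !mxE /e !enum_rankK eqxx mulr1n mulr_suml; apply: eq_bigr => y _.
  by rewrite -mulrA -psiD; congr (_ * psi _) => /=; ring.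
rewrite !mxE; have [<-|_ _] := eqVneq (e z); last by rewrite mulr0.
by rewrite /e enum_valK eqxx.
Qed.

(** Parseval over all frequencies would give [q] times the correlation of [w] with its translate;
    the missing frequency 0 accounts for the subtracted square. *)
Lemma dotmx_fourier w g : dotmx (fourier w *m aff_repr g) (fourier w) =
  (q * \sum_y w y * w (y * val g.2 + g.1) - (\sum_y w y) ^+ 2)%:C%C.
Proof.
have conj_fourier x : (\sum_z (w z)%:C%C * psi (val (e x) * z))^*%C =
    \sum_z (w z)%:C%C * psi (- (val (e x) * z)).
  rewrite rmorph_sum /=; apply: eq_bigr => z _.
  by rewrite rmorphM psiN; congr (_ * _); apply: conjc_real.
transitivity (\sum_y \sum_z (w y * w z)%:C%C *
    \sum_x psi (val (e x) * (y * val g.2 + g.1 - z))).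
  rewrite fourier_aff_repr dotmxE mxE.
  under eq_bigr => x _.
    rewrite !mxE [Num.conj _]conj_fourier mulr_suml.
    under eq_bigr => y _ do rewrite mulr_sumr.
    over.
  rewrite exchange_big; apply: eq_bigr => y _.
  rewrite exchange_big; apply: eq_bigr => z _.
  rewrite mulr_sumr; apply: eq_bigr => x _.
  by rewrite mulrBr psiD rmorphM /= -!mulrA; congr (_ * _); rewrite mulrCA.
rewrite rmorphB rmorphM rmorphXn /= !rmorph_sum /= expr2 mulr_suml mulr_sumr.
rewrite -sumrB; apply: eq_bigr => y _.
set t := _ + g.1.
under eq_bigr => z _ do rewrite sum_char_unit subr_eq0 mulrBr mulr1.
rewrite sumrB; congr (_ - _).
  rewrite (bigD1 t) //= eqxx big1 ?addr0 => [|z /negPf zt].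
    by rewrite -!rmorphM /= -[X in _ * X](rmorph_nat (real_complex R)) -rmorphM mulrC.
  by rewrite eq_sym zt mulr0.
by rewrite mulr_sumr; apply: eq_bigr => z _; rewrite rmorphM.
Qed.

(* Averaging over the translations isolates one coordinate, which the dilations
   then move to any other one. *)
Lemma aff_repr_translations i :
  \sum_v psi (- (val (e i) * v)) *: aff_repr (v, 1%g) = #|F|%:R *: delta_mx i i.
Proof.
apply/matrixP => z x; rewrite summxE !mxE.
transitivity ((\sum_v psi (v * (val (e x) - val (e i)))) *+ (z == x)).
  rewrite -sumrMnl; apply: eq_bigr => v _.
  rewrite !mxE /= mul1g (inj_eq e_inj) mulrnAr -psiD.
  by congr (psi _ *+ _); ring.
rewrite sum_char subr_eq0 (inj_eq val_inj) (inj_eq e_inj).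
have [->|/negPf xi] := eqVneq x i; last by rewrite andbF mul0rn mulr0.
by rewrite andbT mulr_natr.
Qed.

Lemma aff_repr_irr : mx_irreducible aff_repr.
Proof.
have n_gt0 : (0 < n)%N by apply/card_gt0P; exists 1%g.
split; [exact: mxmodule1 | by rewrite -mxrank_eq0 mxrank1 -lt0n |].
move=> U /mxmoduleP Umod _ /matrix0Pn[r [i Uri]].
have q_neq0 : #|F|%:R != 0 :> R[i].
  by rewrite pnatr_eq0 -lt0n; apply/card_gt0P; exists 0.
have Ui : ((delta_mx 0 i : 'rV_n) <= U)%MS.
  have -> : delta_mx 0 i = (#|F|%:R * U r i)^-1 *:
      (row r U *m (#|F|%:R *: delta_mx i i)) :> 'rV_n.
    have -> : row r U *m (#|F|%:R *: delta_mx i i) =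
        (#|F|%:R * U r i) *: delta_mx 0 i.
      apply/rowP => x; rewrite -scalemxAr !mxE -mulrA; congr (_ * _).
      rewrite (bigD1 i) //= big1 => [|l /negPf li].
        by rewrite !mxE !eqxx addr0.
      by rewrite !mxE li mulr0.
    by rewrite scalerA mulVf ?scale1r // mulf_neq0.
  rewrite -aff_repr_translations scalemx_sub // mulmx_sumr summx_sub // => v _.
  rewrite -scalemxAr scalemx_sub //.
  exact: submx_trans (submxMr _ (row_sub r U)) (Umod _ (in_setT _)).
apply/row_subP => j; rewrite row1.
pose g : aff F := (0, (e i * (e j)^-1)%g).
suff -> : delta_mx 0 j = (delta_mx 0 i : 'rV_n) *m aff_repr g.
  exact: submx_trans (submxMr _ Ui) (Umod _ (in_setT _)).
rewrite -rowE; apply/rowP => x; rewrite !mxE /= mulr0 psi0.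
have -> : (e i == e i * (e j)^-1 * e x)%g = (x == j).
  rewrite -{1}[e i]mulg1 -mulgA (inj_eq (mulgI _)) -(inj_eq (mulgI (e j))).
  by rewrite mulg1 mulKVg eq_sym (inj_eq e_inj).
by [].
Qed.

End AffineRepresentation.

(** * A nontrivial additive character of a prime field *)

Section PrimeFieldCharacter.
Variables (R : realType) (p : nat).
Hypothesis p_pr : prime p.

(** Take a root of [1 + X + ... + X^(p-1)]; it cannot be 1, where this polynomial takes the value
    [p]. *)
Lemma unity_root_neq1 : exists2 z : R[i], z ^+ p = 1 & z != 1.
Proof.
have p_gt1 := prime_gt1 p_pr.
have sizep : size (\poly_(i < p) (1 : R[i])) = p.
  by rewrite size_poly_eq ?oner_neq0.
have [|z] := closed_rootP (\poly_(i < p) (1 : R[i])) _.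
  by rewrite sizep neq_ltn p_gt1 orbT.
rewrite /root horner_poly => /eqP.
rewrite (eq_bigr (fun i : 'I_p => z ^+ i)) => [sumz|i _]; last by rewrite mul1r.
exists z; first by apply/eqP; rewrite -subr_eq0 subrX1 sumz mulr0.
apply/eqP => z1; move/eqP: sumz; rewrite (eq_bigr (fun=> 1)) => [|i _].
  by rewrite sumr_const card_ord pnatr_eq0 -leqn0 leqNgt prime_gt0.
by rewrite z1 expr1n.
Qed.

Lemma prime_field_char : exists psi : 'F_p -> R[i],
  [/\ {morph psi : a b / a + b >-> a * b}, psi 0 = 1,
      forall a, psi (- a) = (psi a)^*%C & exists a, psi a != 1].
Proof.
have [z zp z1] := unity_root_neq1; pose psi (a : 'F_p) := z ^+ a.
have psiD : {morph psi : a b / a + b >-> a * b}.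
  (* Addition in ['F_p] adds representatives modulo [p], and [z ^+ p = 1] absorbs the reduction. *)
  move=> a b; rewrite /psi -exprD -[RHS](expr_mod _ zp); congr (z ^+ _).
  exact: (congr1 (modn (a + b)%N) (Fp_cast p_pr)).
have psi0 : psi 0 = 1 by [].
exists psi; split => // [a|]; last by exists 1; rewrite /psi /= modn_small.
have psi_norm : `|psi a| = 1.
  apply/eqP; rewrite -(pexpr_eq1 (prime_gt0 p_pr)) ?normr_ge0 //.
  by rewrite -normrX -exprM mulnC exprM zp expr1n normr1.
have psi_neq0 : psi a != 0 by rewrite -normr_eq0 psi_norm oner_eq0.
apply: (mulfI psi_neq0); rewrite -psiD subrr psi0.
by rewrite -[(psi a)^*%C]/(Num.conj _) -normCK psi_norm expr1n.
Qed.

End PrimeFieldCharacter.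

(** * Lower bound for the norm of averages *)

Lemma minn_le_sqrt (R : realType) (a b : nat) :
  (minn a b)%:R <= Num.sqrt a%:R * Num.sqrt b%:R :> R.
Proof.
rewrite -sqrtrM ?ler0n // -[leLHS]ger0_norm ?ler0n // -sqrtr_sqr ler_wsqrtr //.
by rewrite expr2 -!natrM ler_nat leq_mul ?geq_minl ?geq_minr.
Qed.

Lemma sqrt_nat_le (R : realType) (a : nat) : Num.sqrt a%:R <= a%:R :> R.
Proof.
rewrite -[leRHS]ger0_norm ?ler0n // -sqrtr_sqr ler_wsqrtr //.
by rewrite expr2 -natrM ler_nat; case: a => // a; rewrite leq_pmulr.
Qed.

Section NormBound.
Variables (R : realType) (F : finFieldType) (psi : F -> R[i]).
Hypothesis psiD : {morph psi : a b / a + b >-> a * b}.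
Hypothesis psi0 : psi 0 = 1.
Hypothesis psiN : forall a, psi (- a) = (psi a)^*%C.
Hypothesis psi_nontrivial : exists a, psi a != 1.

(** With test vector [fourier psi w], the Rayleigh quotient is the mean of
    [(q X - S^2) / (q N - S^2)]. Its numerator loses at most [2 d q N], and [3 S^2 <= q N] makes
    this at most [3 d (q N - S^2)]. *)
Lemma opnorm_aff_repr_ge (k : nat) (g : 'I_k -> aff F) (w : F -> R) (N d : R) :
    (0 < k)%N -> 0 < N -> 0 <= d -> \sum_y w y ^+ 2 = N ->
    (\sum_y w y) ^+ 2 <= N ^+ 2 -> 3 * N <= #|F|%:R ->
    (forall j, (1 - 2 * d) * N <= \sum_y w y * w (y * val (g j).2 + (g j).1)) ->
  1 - 3 * d <= opnorm (k%:R^-1 *: \sum_(j < k) aff_repr psiD psi0 (g j)).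
Proof.
set q := #|F|%:R; set S := \sum_y w y.
move=> k_gt0 N_gt0 d_ge0 w2 S_le N_le overlap.
pose X (h : aff F) := \sum_y w y * w (y * val h.2 + h.1).
have X1 : X 1%g = N.
  by rewrite -w2; apply: eq_bigr => y _; rewrite /= mulr1 addr0.
have sq_gt0 : 0 < q * N - S ^+ 2 by nra.
have avg_ge : (1 - 3 * d) * (q * N - S ^+ 2) <=
    k%:R^-1 * \sum_(j < k) (q * X (g j) - S ^+ 2).
  set c := leLHS; have -> : c = k%:R^-1 * \sum_(j < k) c.
    rewrite sumr_const card_ord -[c *+ k]mulr_natr mulrCA mulVf ?mulr1 //.
    by rewrite pnatr_eq0 -lt0n.
  rewrite ler_wpM2l ?invr_ge0 ?ler0n //; apply: ler_sum => j _; rewrite /c.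
  have S_le' : 3 * S ^+ 2 <= q * N by nra.
  have qX_ge := ler_wpM2l (ler0n R #|F|) (overlap j).
  have dS_le := ler_wpM2l d_ge0 S_le'.
  by move: qX_ge; rewrite -/(X (g j)) -/q; lra.
pose u := fourier psi w.
have dot_u h := dotmx_fourier psiD psi0 psiN psi_nontrivial w h.
have dot_uu : dotmx u u = (q * N - S ^+ 2)%:C%C.
  by rewrite -X1 -dot_u repr_mx1 mulmx1.
have dot_uA :
    dotmx (u *m (k%:R^-1 *: \sum_(j < k) aff_repr psiD psi0 (g j))) u =
    (k%:R^-1 * \sum_(j < k) (q * X (g j) - S ^+ 2))%:C%C.
  rewrite -scalemxAr mulmx_sumr linearZl_LR linear_sumlz rmorphM fmorphV.
  rewrite rmorph_nat rmorph_sum; congr (_ * _); apply: eq_bigr => j _.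
  exact: dot_u.
apply: (@opnorm_ge _ _ u); last by rewrite dot_uu dot_uA.
apply: contraTneq sq_gt0 => u0.
by move: dot_uu; rewrite u0 linear0l => -[<-]; rewrite ltxx.
Qed.

(** Apply the previous bound to the square root of [mult] with [d = 1 / l.+1]. By [minn_le_sqrt],
    almost invariance of the multiplicities becomes overlap of their square roots; by [sqrt_nat_le],
    the sum of the square roots is at most [N]. *)
Lemma opnorm_aff_repr (k l : nat) (g : 'I_k -> aff F) :
    (0 < k)%N -> (l.+1 ^ (k + l.+1 ^ k * k).+1 <= #|F|)%N -> (2 <= l)%N ->
  1 - 3 / l.+1%:R <=
    opnorm (k%:R^-1 *: \sum_(j < k) aff_repr psiD psi0 (g j)).
Proof.
move=> k_gt0 F_large l_ge2.
pose s j := val (g j).2; pose v j := (g j).1.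
have s_neq0 j : s j != 0 by apply: unit_neq0.
pose N := #|{: config k l}|; pose m : F -> nat := mult l s v.
have N_gt0 : (0 < N)%N by rewrite /N card_config expn_gt0.
(* The extra 1 in the exponent provides the factor [l.+1 >= 3] needed for [3 * N <= #|F|]. *)
have N_le : (l.+1 * N <= #|F|)%N by rewrite /N card_config -expnS.
have L_gt0 : 0 < l.+1%:R :> R by rewrite ltr0n.
have sum_m : \sum_y (m y)%:R = N%:R :> R by rewrite -natr_sum sum_mult.
apply: (@opnorm_aff_repr_ge _ _ (fun y => Num.sqrt (m y)%:R) N%:R).
- by [].
- by rewrite ltr0n.
- by rewrite invr_ge0 ler0n.
- by rewrite -sum_m; apply: eq_bigr => y _; rewrite sqr_sqrtr ?ler0n.
- rewrite lerXn2r ?nnegrE ?ler0n ?sumr_ge0 // => [y _|]; first exact: sqrtr_ge0.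
  by rewrite -sum_m ler_sum // => y _; apply: sqrt_nat_le.
- by rewrite -natrM ler_nat (leq_trans _ N_le) // leq_mul2r ltnS l_ge2 orbT.
move=> j; apply: (@le_trans _ _ #|interior l j|%:R).
  have := card_interior l j; rewrite -(ler_nat R) natrD !natrM -/N.
  rewrite -[in X in _ -> X](ler_pM2l L_gt0) => card_le.
  rewrite mulrA mulrBr mulr1 [_ * (2 / _)]mulrCA divff ?gt_eqF // mulr1 mulrBl.
  by rewrite lerBlDr.
apply: le_trans (_ : (\sum_y minn (m y) (m (y * s j + v j)%R))%N%:R <= _).
  by rewrite ler_nat mult_invariant.
by rewrite natr_sum ler_sum // => y _; apply: minn_le_sqrt.
Qed.

End NormBound.

(** * Size of the Folner set against the prime *)

Section Growth.
Variable R : realType.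

(* [2 * (1 + k + L^k k) ln L <= 6 * 2^k * L^(2k) <= (12 L^2)^k], which is at
   most [ln |G| <= 2 ln p] by the hypothesis on [k]. *)
Lemma size_le_prime (L k p : nat) :
    (1 < L)%N -> (0 < k)%N -> (1 < p)%N ->
    k%:R <= (ln (12 * L%:R ^+ 2 : R))^-1 * ln (ln (p * p.-1)%:R) ->
  (L ^ (k + L ^ k * k).+1 <= p)%N.
Proof.
move=> L_gt1 k_gt0 p_gt1; have L_gt0 := ltnW L_gt1; have p_gt0 := ltnW p_gt1.
set B : R := 12 * _; set y : R := ln (p * p.-1)%:R.
have L_ge1 : 1 <= L%:R :> R by rewrite ler1n ltnW.
have B_gt1 : 1 < B by rewrite /B; nra.
have B_gt0 := lt_trans ltr01 B_gt1.
have lnB_gt0 : 0 < ln B by rewrite ln_gt0.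
rewrite mulrC ler_pdivlMr // => k_le.
have k_real : 0 < k%:R :> R by rewrite ltr0n.
have y_gt0 : 0 < y.
  (* If [y <= 0], then [ln y] has its default value 0, and the hypothesis on [k] forces
     [k * ln B <= 0]. *)
  rewrite ltNge; apply/negP => /ln0 lny0.
  have : 0 < k%:R * ln B by rewrite mulr_gt0.
  by rewrite ltNge; move: k_le; rewrite lny0 => ->.
have p_real : 0 < p%:R :> R by rewrite ltr0n ltnW.
have B_le : B ^+ k <= 2 * ln p%:R.
  apply: (@le_trans _ _ y).
    by rewrite -ler_ln ?posrE ?exprn_gt0 // lnXn // -mulr_natl.
  have -> : 2 * ln p%:R = ln (p%:R ^+ 2) :> R by rewrite lnXn // mulr2n; ring.
  rewrite /y ler_ln ?posrE ?exprn_gt0 //.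
    by rewrite -natrX ler_nat expnS expn1 leq_mul // leq_pred.
  by rewrite ltr0n muln_gt0 (ltnW p_gt1) -ltnS prednK // ltnW.
rewrite -(ler_nat R) natrX -ler_ln ?posrE ?exprn_gt0 ?ltr0n //.
rewrite lnXn ?ltr0n // -[leLHS]mulr_natl.
have lnL_le : ln L%:R <= L%:R :> R by rewrite ltW // ln_sublinear // ltr0n ltnW.
have exp_le : (2 * ((k + L ^ k * k).+1 * L) <= (12 * L ^ 2) ^ k)%N.
  have t_gt0 : (0 < L ^ k)%N by rewrite expn_gt0 (ltnW L_gt1).
  have L_le : (L <= L ^ k)%N by rewrite -{1}[L]expn1 leq_pexp2l // ltnW.
  rewrite expnMn -expnM (mulnC 2%N k) expnM -[12%N]/(6 * 2)%N expnMn.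
  move: (L ^ k)%N t_gt0 L_le => t t_gt0 L_le.
  have k_le2 : (k <= 2 ^ k)%N by rewrite ltnW // ltn_expl.
  have kt_le : (k <= t * k)%N by rewrite leq_pmull.
  have kt_gt0 : (0 < t * k)%N by rewrite muln_gt0 t_gt0.
  have le_kt : ((k + t * k).+1 * L <= 3 * (t * k) * t)%N.
    apply: leq_mul => //.
    by rewrite mulSn mul2n -addnn -addnS leq_add // -addn1 leq_add.
  apply: (@leq_trans (6 * 2 ^ k * t ^ 2)%N).
    rewrite -[6%N]/(2 * 3)%N -!(mulnA 2%N) leq_mul2l /=.
    apply: leq_trans le_kt _; rewrite -!(mulnA 3%N) leq_mul2l /=.
    by rewrite [(t * k)%N]mulnC -mulnA mulnn leq_mul2r k_le2 orbT.
  apply: leq_mul => //; apply: leq_mul => //.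
  exact: (@leq_pexp2l 6 1 k).
have exp_le_real : 2 * ((k + L ^ k * k).+1%:R * L%:R) <= B ^+ k.
  by move: exp_le; rewrite -(ler_nat R) natrX (natrM R 12) natrX !natrM.
apply: le_trans (ler_wpM2l (ler0n R _) lnL_le) _.
by rewrite -(@ler_pM2l _ 2) // (le_trans exp_le_real).
Qed.

End Growth.

(** * An increasing sequence of primes, and the theorem *)

Fixpoint large_prime (i : nat) : nat :=
  if i is j.+1 then s2val (prime_above (large_prime j)) else 3.

Lemma large_prime_prime i : prime (large_prime i).
Proof. by case: i => //= i; case: prime_above. Qed.

Lemma large_prime_mono : {homo large_prime : i j / (i < j)%N}.
Proof.
by apply: homo_ltn => [? ? ?|i /=]; [exact: ltn_trans | case: prime_above].
Qed.

(** The sequence starts at 3 so that the representation, of dimension [p - 1], is never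
    one-dimensional. *)
Lemma large_prime_gt2 i : (2 < large_prime i)%N.
Proof. by case: i => // i; apply: ltn_trans (large_prime_mono (ltn0Sn i)). Qed.

Lemma card_aff_prime p : prime p -> #|{: aff 'F_p}| = (p * p.-1)%N.
Proof. by move=> p_pr; rewrite card_aff card_Fp. Qed.

Theorem theorem1 :
  forall (R : realType) (eps : R), 0 < eps ->
  exists c : R, 0 < c /\
  exists gT : nat -> finGroupType,
    (forall i j : nat, i <> j -> ~ ([set: gT i] \isog [set: gT j])) /\
    forall i : nat,
    exists (n : nat) (rho : mx_representation R[i] [set: gT i]%G n),
      [/\ unitary_repr rho,
          mx_irreducible rho,
          ~ trivial_repr rho,
          (forall (k : nat) (g : 'I_k -> gT i),
             (0 < k)%N -> k%:R <= c * ln (ln (#|gT i|%:R)) ->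
             1 - eps <= opnorm (k%:R^-1 *: \sum_(j < k) rho (g j)))
        & (forall S : {set gT i},
             S != set0 -> #|S|%:R <= c * ln (ln (#|gT i|%:R)) ->
             resists rho eps S)].
Proof.
move=> R eps eps_gt0.
(* The inequality is strict so that the norm strictly exceeds [1 - eps], as [resists] demands. *)
have [l l_ge2 l_eps] : exists2 l, (2 <= l)%N & 3 / l.+1%:R < eps.
  have [m m_gt] : exists m : nat, 3 / eps < m%:R.
    by exists (Num.bound (3 / eps)); apply: archi_boundP; rewrite divr_ge0 // ltW.
  exists m.+2 => //; rewrite ltr_pdivrMr ?ltr0n // mulrC -ltr_pdivrMr //.
  by apply: lt_trans m_gt _; rewrite ltr_nat; lia.
(* This is the constant of [size_le_prime] for [L = l.+1]; it depends on [eps] through [l]. *)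
exists (ln (12 * l.+1%:R ^+ 2 : R))^-1; split.
  rewrite invr_gt0 ln_gt0 //.
  have : 1 <= l.+1%:R :> R by rewrite ler1n.
  nra.
exists (fun i => aff 'F_(large_prime i)); split.
  (* The groups are told apart by their orders [p * (p - 1)], which increase strictly with [p]. *)
  move=> i j ij /card_isog; rewrite !cardsT !card_aff_prime ?large_prime_prime //.
  wlog lt_ij : i j ij / (i < j)%N => [IH|].
    by case: (ltngtP i j) ij => // [ij|ij] _; [apply: IH | move/esym; apply: IH]; lia.
  have := large_prime_mono lt_ij; have := large_prime_gt2 i.
  case: (large_prime i) (large_prime j) => // a [//|b] /= _; rewrite ltnS => ab.
  by apply/eqP; rewrite neq_ltn ltn_mul.
move=> i; set p := large_prime i; have p_pr : prime p := large_prime_prime i.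
have [psi [psiD psi0 psiN psi_nontrivial]] := prime_field_char R p_pr.
have norm_gt k (g : 'I_k -> aff 'F_p) : (0 < k)%N ->
    k%:R <= (ln (12 * l.+1%:R ^+ 2 : R))^-1 * ln (ln #|{: aff 'F_p}|%:R) ->
    1 - eps < opnorm (k%:R^-1 *: \sum_(j < k) aff_repr psiD psi0 (g j)).
  move=> k_gt0; rewrite card_aff_prime // => k_le.
  have bound := opnorm_aff_repr psiD psi0 psiN psi_nontrivial.
  apply: lt_le_trans (bound k l g k_gt0 _ l_ge2); first by rewrite ltrD2l ltrN2.
  rewrite card_Fp //; apply: size_le_prime k_le => //; first by rewrite ltnS ltnW.
  exact: prime_gt1.
exists #|{: {unit 'F_p}}|, (aff_repr psiD psi0); split.
- exact: aff_repr_unitary.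
- exact: aff_repr_irr.
- case=> n1 _; have := large_prime_gt2 i; rewrite -/p.
  have := card_finField_unit 'F_p; rewrite cardsT n1 card_Fp //.
  lia.
- by move=> k g k_gt0 k_le; apply/ltW/norm_gt.
(* Enumerating [S] turns it into a family of [#|S|] group elements. *)
move=> S S_neq0 S_le; rewrite /resists /expanding => S_exp.
have := norm_gt #|S| (fun j => enum_val j) _ S_le.
rewrite -big_enum_val /= card_gt0 => /(_ S_neq0).
by rewrite ltNge S_exp.
Qed.
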